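(* Let $f_1:S_1\to O$ and $f_2:S_2\to O$ be regular fibrations over a common base $O$, with regular lifting functions $L_{f_1}, L_{f_2}$, and let $r_o\in O$, $F^i_{r_o}=f_i^{-1}(r_o)$ for $i=1,2$. Suppose the $Lf$-functions of $f_1$ and $f_2$ are conjugate by a homotopy equivalence $g:F^1_{r_o}\to F^2_{r_o}$ with homotopy inverse $g'$, i.e. $\Theta_{L_{f_1}}\simeq g'\circ\Theta_{L_{f_2}}\circ(\mathrm{id}_{\Omega(O,r_o)}\times g)$. Then there are two fiber maps $$D:\Sigma(S_1,F^1_{r_o})\to\Sigma(S_2,F^2_{r_o}),\qquad R:\Sigma(S_2,F^2_{r_o})\to\Sigma(S_1,F^1_{r_o})$$ over $g\times g$ and $g'\times g'$ respectively, that is, continuous maps with $\Phi_2\circ D=(g\times g)\circ\Phi_1$ and $\Phi_1\circ R=(g'\times g')\circ\Phi_2$.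
   Context: All spaces are Hausdorff; $I=[0,1]$, $S^I$ is the space of paths in $S$ with the compact-open topology, $\widetilde{s}$ is the constant path at $s$, $\Omega(O,r_o)\subset O^I$ is the space of loops at $r_o$, and $\simeq$ denotes homotopy of maps. ''Fibration'' means Hurewicz fibration. For a fibration $f:S\to O$ let $\bigtriangleup f=\{(s,\alpha)\in S\times O^I: f(s)=\alpha(0)\}$. A lifting function for $f$ is a continuous map $L_f:\bigtriangleup f\to S^I$ with $L_f(s,\alpha)(0)=s$ and $f\circ L_f(s,\alpha)=\alpha$; it is regular if $L_f(s,f\circ\widetilde{s})=\widetilde{s}$ for all $s\in S$. A fibration is regular if it has a regular lifting function. For $F_{r_o}=f^{-1}(r_o)$, the $Lf$-function of $f$ induced by $L_f$ is $\Theta_{L_f}:\Omega(O,r_o)\times F_{r_o}\to F_{r_o}$, $\Theta_{L_f}(\alpha,s)=L_f(s,\alpha)(1)$. For a subspace $F\subset S$, $\Sigma(S,F)=\{\alpha\in S^I:\alpha(0)\in F,\ \alpha(1)\in F\}$. For $i=1,2$, $\Phi_i:\Sigma(S_i,F^i_{r_o})\to F^i_{r_o}\times F^i_{r_o}$ is the fibration $\Phi_i(\alpha)=(\alpha(0),\alpha(1))$. *)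

(* Defs.v *)
From HB Require Import structures.
From mathcomp Require Import all_boot all_order all_algebra.
From mathcomp Require Import boolp classical_sets functions set_interval.
From mathcomp Require Import reals topology.

Set Implicit Arguments.
Unset Strict Implicit.
Unset Printing Implicit Defensive.

Import Order.TTheory GRing.Theory Num.Theory.
Import numFieldTopology.Exports.
Local Open Scope classical_set_scope.
Local Open Scope ring_scope.

(* A subspace {x : T | A x} is [set_type A], with the topology induced by
   [set_val]. A map is an element of [continuousType]. *)

Definition unit_interval (R : realType) : topologicalType :=
  set_type [set` `[0 : R, 1]].

Lemma unit_interval0 (R : realType) : [set` `[0 : R, 1]] 0.
Proof. by rewrite /= in_itv /= lexx ler01. Qed.

Lemma unit_interval1 (R : realType) : [set` `[0 : R, 1]] 1.
Proof. by rewrite /= in_itv /= lexx ler01. Qed.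

Definition i0 {R : realType} : unit_interval R :=
  exist _ 0 (mem_set (unit_interval0 R)).
Definition i1 {R : realType} : unit_interval R :=
  exist _ 1 (mem_set (unit_interval1 R)).

Definition path_space (R : realType) (S : topologicalType) : Type :=
  continuousType (unit_interval R) S.

HB.instance Definition _ (R : realType) (S : topologicalType) :=
  Choice.on (path_space R S).
HB.instance Definition _ (R : realType) (S : topologicalType) :=
  Topological.copy (path_space R S)
    (@initial_topology (path_space R S) {compact-open, unit_interval R -> S}
       (fun a => a)).

Definition const_path (R : realType) (S : topologicalType) (s : S) :
  path_space R S := cst s.

Definition map_path (R : realType) (S O : topologicalType)
  (f : continuousType S O) (a : path_space R S) : path_space R O := f \o a.

Definition loop_space (R : realType) (O : topologicalType) (r : O) :
    topologicalType :=
  set_type [set a : path_space R O | a i0 = r /\ a i1 = r].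

Definition fiber_set (S O : topologicalType) (f : continuousType S O) (r : O) :
  set S := f @^-1` [set r].

Definition fiber (S O : topologicalType) (f : continuousType S O) (r : O) :
    topologicalType :=
  set_type (fiber_set f r).

Definition prod_map (A B C D : Type) (f : A -> B) (g : C -> D) (p : A * C) :
  B * D := (f p.1, g p.2).

(* The continuity of H forces that of f and g, so these are bare functions. *)
Definition homotopic (R : realType) (X Y : topologicalType) (f g : X -> Y) :=
  exists H : continuousType (X * unit_interval R)%type Y,
    (forall x, H (x, i0) = f x) /\ (forall x, H (x, i1) = g x).

Definition homotopy_inverse (R : realType) (X Y : topologicalType)
    (g : continuousType X Y) (g' : continuousType Y X) :=
  homotopic R (g' \o g) idfun /\ homotopic R (g \o g') idfun.

(* Test spaces are Hausdorff because all spaces are assumed to be. *)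
Definition hurewicz_fibration (R : realType) (S O : topologicalType)
    (f : continuousType S O) :=
  forall X : topologicalType, hausdorff_space X ->
  forall (h : continuousType X S)
    (G : continuousType (X * unit_interval R)%type O),
  (forall x, G (x, i0) = f (h x)) ->
  exists H : continuousType (X * unit_interval R)%type S,
    (forall x, H (x, i0) = h x) /\ (forall z, f (H z) = G z).

Definition lift_domain (R : realType) (S O : topologicalType)
    (f : continuousType S O) : topologicalType :=
  set_type [set p : S * path_space R O | f p.1 = p.2 i0].

Definition mk_lift_domain (R : realType) (S O : topologicalType)
    (f : continuousType S O) (s : S) (a : path_space R O)
    (e : f s = a i0) : lift_domain R f :=
  exist _ (s, a) (mem_set e).

Record lifting_function (R : realType) (S O : topologicalType)
    (f : continuousType S O) := LiftingFunction {
  lift_map :> continuousType (lift_domain R f) (path_space R S);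
  lift_start : forall s (a : path_space R O) (e : f s = a i0),
    lift_map (mk_lift_domain e) i0 = s;
  lift_over : forall s (a : path_space R O) (e : f s = a i0),
    map_path f (lift_map (mk_lift_domain e)) = a
}.

Definition regular_lifting (R : realType) (S O : topologicalType)
    (f : continuousType S O) (L : lifting_function R f) :=
  forall s : S,
    L (@mk_lift_domain R S O f s (map_path f (const_path R s)) erefl) =
    const_path R s.

Definition regular_fibration (R : realType) (S O : topologicalType)
    (f : continuousType S O) :=
  hurewicz_fibration R f /\ exists L : lifting_function R f, regular_lifting L.

Section Lf_function.
Variables (R : realType) (S O : topologicalType) (f : continuousType S O).
Variables (L : lifting_function R f) (r : O).

Lemma loop_fiber_start (a : loop_space R r) (s : fiber f r) :
  f (set_val s) = set_val a i0.
Proof. by rewrite (set_valP s) (set_valP a).1. Qed.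

Lemma Lf_function_subproof (a : loop_space R r) (s : fiber f r) :
  f (L (mk_lift_domain (loop_fiber_start a s)) i1) = r.
Proof.
have /continuousEP/(_ i1) /= -> := lift_over L (loop_fiber_start a s).
exact: (set_valP a).2.
Qed.

Definition Lf_function (p : loop_space R r * fiber f r) : fiber f r :=
  exist _ (L (mk_lift_domain (loop_fiber_start p.1 p.2)) i1)
          (mem_set (Lf_function_subproof p.1 p.2)).

End Lf_function.

Definition relative_paths (R : realType) (S : topologicalType) (F : set S) :
    topologicalType :=
  set_type [set a : path_space R S | F (a i0) /\ F (a i1)].

Definition endpoints (R : realType) (S : topologicalType) (F : set S)
    (a : relative_paths R F) : set_type F * set_type F :=
  (exist _ (set_val a i0) (mem_set (set_valP a).1),
   exist _ (set_val a i1) (mem_set (set_valP a).2)).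

(* Main.v *)
(** A homotopy [H : X * I -> S] between maps with values in a subspace [F] is,
    by currying into the compact-open topology, the same thing as a map from
    [X] to the relative paths of [(S, F)] with prescribed endpoints. So [D]
    amounts to a homotopy in [S2] from [a |-> g (a 0)] to [a |-> g (a 1)]
    defined on the relative paths of [S1]. Write [Ti] for the Lf-functions.
    Lifting [f1 \o a] from [g (a 0)] leads to [T2 (f1 \o a, g (a 0))]; from
    there on the homotopy stays in the fiber:
      [T2 (f1 \o a, g (a 0)) ~ g (g' (T2 (f1 \o a, g (a 0))))
         ~ g (T1 (f1 \o a, a 0)) ~ g (a 1)].
    The last step holds because [T1 (f1 \o a, a 0) ~ a 1] for every regular
    lifting function. The construction of [E] is analogous, with
      [T1 (f2 \o a, g' (a 0)) ~ g' (T2 (f2 \o a, g (g' (a 0))))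
         ~ g' (T2 (f2 \o a, a 0)) ~ g' (a 1)]. *)

Require Import Defs.
From HB Require Import structures.
From mathcomp Require Import all_boot all_order all_algebra.
From mathcomp Require Import boolp classical_sets functions.
From mathcomp Require Import reals topology normedtype.

Set Implicit Arguments.
Unset Strict Implicit.
Unset Printing Implicit Defensive.

Import Order.TTheory GRing.Theory Num.Theory.
Import numFieldNormedType.Exports.
Local Open Scope classical_set_scope.
Local Open Scope ring_scope.

(** * Continuity of elementary maps on products and subspaces *)

Lemma comp_continuous (X Y Z : topologicalType) (f : X -> Y) (g : Y -> Z) :
  continuous f -> continuous g -> continuous (g \o f).
Proof. by move=> cf cg x; apply: continuous_comp; [exact: cf|exact: cg]. Qed.

Lemma pair_continuous (X Y Z : topologicalType) (f : X -> Y) (g : X -> Z) :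
  continuous f -> continuous g -> continuous (fun x => (f x, g x)).
Proof. by move=> cf cg x; apply: cvg_pair; [exact: cf|exact: cg]. Qed.

Lemma fst_continuous (X Y : topologicalType) : continuous (@fst X Y).
Proof. by move=> x; exact: cvg_fst. Qed.

Lemma snd_continuous (X Y : topologicalType) : continuous (@snd X Y).
Proof. by move=> x; exact: cvg_snd. Qed.

Lemma pairr_continuous (X Y : topologicalType) (x : X) :
  continuous (fun y : Y => (x, y)).
Proof.
by apply: pair_continuous; [exact: cst_continuous|move=> ?; exact: cvg_id].
Qed.

Lemma set_val_continuous (X : topologicalType) (A : set X) :
  continuous (set_val : set_type A -> X).
Proof. exact: initial_continuous. Qed.

Lemma continuous_set_type (X Y : topologicalType) (A : set Y)
    (f : X -> set_type A) :
  continuous (set_val \o f) -> continuous f.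
Proof. exact: continuous_comp_initial. Qed.

(** * The unit interval: retraction from the line, compactness, maximum *)

Section unit_interval.
Variable R : realType.
Local Notation I := (unit_interval R).

Lemma clamp_subproof (x : R) : [set` `[0 : R, 1]] (Num.max 0 (Num.min x 1)).
Proof.
by rewrite /= in_itv /= le_max lexx /= ge_max ler01 /= ge_min lexx orbT.
Qed.

(** The retraction of the line onto the interval. Parameters can be given by real formulas, with no
    membership proof to carry along. *)
Definition clamp (x : R) : I :=
  exist _ (Num.max 0 (Num.min x 1)) (mem_set (clamp_subproof x)).

Lemma clamp_le0 (x : R) : x <= 0 -> clamp x = i0.
Proof.
move=> x0; apply: val_inj => /=.
by rewrite (min_idPl (le_trans x0 ler01)); exact/max_idPl.
Qed.

Lemma clamp_ge1 (x : R) : 1 <= x -> clamp x = i1.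
Proof.
by move=> x1; apply: val_inj => /=; rewrite (min_idPr x1) (max_idPr ler01).
Qed.

Lemma clampK (t : I) : clamp (set_val t) = t.
Proof.
have := set_valP t; rewrite /= in_itv /= => /andP[t0 t1].
by apply: val_inj; rewrite /= (min_idPl t1) (max_idPr t0).
Qed.

Lemma clamp_continuous : continuous clamp.
Proof.
apply: continuous_set_type => x.
apply: (@continuous_max R R (cst 0) (fun x => Num.min x 1));
  first exact: cvg_cst.
by apply: (@continuous_min R R id (cst 1)) => //; exact: cvg_cst.
Qed.

Lemma unit_interval_compact : compact [set: I].
Proof.
have -> : [set: I] = clamp @` [set` `[0 : R, 1]].
  apply/seteqP; split=> // t _; exists (set_val t); last exact: clampK.
  exact: set_valP.
apply: continuous_compact; last exact: segment_compact.
exact/continuous_subspaceT/clamp_continuous.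
Qed.

Lemma unit_interval_locally_compact : locally_compact [set: I].
Proof.
move=> t _; exists [set: I]; first exact: filterT.
by split; [exact: unit_interval_compact|exact: closedT].
Qed.

Lemma unit_interval_regular : regular_space I.
Proof. exact: (@uniform_regular (set_type [set` `[0 : R, 1]])). Qed.

(** The maximum already lies in the interval; [clamp] only brings it back to the subtype. *)
Definition imax (s t : I) : I := clamp (Num.max (set_val s) (set_val t)).

Lemma imax_continuous (X : topologicalType) (s t : X -> I) :
  continuous s -> continuous t -> continuous (fun x => imax (s x) (t x)).
Proof.
move=> cs ct.
apply: (@comp_continuous _ _ _
  (fun x => Num.max (set_val (s x)) (set_val (t x))));
  last exact: clamp_continuous.
move=> x; apply: (@continuous_max R _ (set_val \o s) (set_val \o t)).
- exact: comp_continuous cs (@set_val_continuous _ _) x.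
- exact: comp_continuous ct (@set_val_continuous _ _) x.
Qed.

Lemma imax0 (t : I) : imax i0 t = t.
Proof.
have := set_valP t; rewrite /= in_itv /= => /andP[t0 _].
by rewrite /imax (max_idPr t0); exact: clampK.
Qed.

Lemma imax1 (t : I) : imax i1 t = i1.
Proof.
have := set_valP t; rewrite /= in_itv /= => /andP[_ t1].
by rewrite /imax (max_idPl t1); exact: (clampK i1).
Qed.

Lemma imaxC (s t : I) : imax s t = imax t s.
Proof. by rewrite /imax maxC. Qed.

End unit_interval.

(** * Path spaces: evaluation and currying *)

Section path_space.
Import ArrowAsCompactOpen.
Variables (R : realType) (S : topologicalType).
Local Notation I := (unit_interval R).

(** Evaluation is the uncurried identity of the path space; uncurrying preserves continuity because
    the interval is locally compact and regular. *)
Lemma path_eval_continuous : continuous (fun p : path_space R S * I => p.1 p.2).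
Proof.
have := @continuous_uncurry_regular (path_space R S) I S (fun a => a).
have -> : uncurry (fun a : path_space R S => a : I -> S) = (fun p => p.1 p.2).
  by apply/funext => -[].
apply; [exact: unit_interval_locally_compact|exact: unit_interval_regular| |].
- exact: initial_continuous.
- by move=> a; exact: cts_fun.
Qed.

Lemma path_app_continuous (X : topologicalType) (a : X -> path_space R S)
    (t : X -> I) :
  continuous a -> continuous t -> continuous (fun x => a x (t x)).
Proof.
move=> ca ct.
exact: (comp_continuous (pair_continuous ca ct) path_eval_continuous).
Qed.

Lemma continuous_path_space (X : topologicalType) (f : X -> path_space R S) :
  continuous (fun p : X * I => f p.1 p.2) -> continuous f.
Proof.
by move=> cf; apply: continuous_comp_initial; exact: (continuous_curry_fun cf).
Qed.

End path_space.

(** * Calculus of homotopies *)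

Section homotopy.
Variable R : realType.
Local Notation I := (unit_interval R).
Implicit Types X Y Z : topologicalType.

Lemma homotopicI X Y (H : X * I -> Y) :
  continuous H -> homotopic R (fun x => H (x, i0)) (fun x => H (x, i1)).
Proof. by move=> cH; exists (mkcts cH); split. Qed.

Lemma homotopic_postcomp X Y Z (k : Y -> Z) (u v : X -> Y) :
  continuous k -> homotopic R u v -> homotopic R (k \o u) (k \o v).
Proof.
move=> ck [H [H0 H1]].
exists (mkcts (comp_continuous (@cts_fun _ _ H) ck)).
by split=> x; rewrite /= /mkcts /= ?H0 ?H1.
Qed.

Lemma homotopic_precomp X Y Z (h : X -> Y) (u v : Y -> Z) :
  continuous h -> homotopic R u v -> homotopic R (u \o h) (v \o h).
Proof.
move=> ch [H [H0 H1]].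
have c : continuous (H \o (fun p : X * I => (h p.1, p.2))).
  apply: comp_continuous; last exact: cts_fun.
  apply: pair_continuous; last exact: snd_continuous.
  exact: comp_continuous (@fst_continuous _ _) ch.
exists (mkcts c).
by split=> x; rewrite /= /mkcts /= ?H0 ?H1.
Qed.

Lemma homotopic_pairr X Y Z (w : X -> Z) (u v : X -> Y) :
  continuous w -> homotopic R u v ->
  homotopic R (fun x => (w x, u x)) (fun x => (w x, v x)).
Proof.
move=> cw [H [H0 H1]].
have c : continuous (fun p : X * I => (w p.1, H p)).
  apply: pair_continuous; last exact: cts_fun.
  exact: comp_continuous (@fst_continuous _ _) cw.
exists (mkcts c).
by split=> x; rewrite /= /mkcts /= ?H0 ?H1.
Qed.

(** Serves both reversal, with [1 - t], and concatenation, with [2 * t] and [2 * t - 1]. *)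
Lemma continuous_reparam X Y (H : X * I -> Y) (phi : I -> R) :
  continuous H -> continuous phi ->
  continuous (fun p : X * I => H (p.1, clamp (phi p.2))).
Proof.
move=> cH cphi.
apply: (@comp_continuous _ _ _ (fun p : X * I => (p.1, clamp (phi p.2)))) => //.
apply: pair_continuous; first exact: fst_continuous.
apply: (@comp_continuous _ _ _ snd (@clamp R \o phi));
  first exact: snd_continuous.
exact: comp_continuous cphi (@clamp_continuous R).
Qed.

Lemma homotopic_sym X Y (u v : X -> Y) : homotopic R u v -> homotopic R v u.
Proof.
move=> [H [H0 H1]].
have c : continuous (fun t : I => 1 - set_val t : R).
  move=> t; apply: (@continuousB R R^o I (cst 1) set_val);
    first exact: cst_continuous.
  exact: set_val_continuous.
exists (mkcts (continuous_reparam (@cts_fun _ _ H) c)).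
split=> x; rewrite /= /mkcts /=.
  by rewrite clamp_ge1 ?H1 // subr0.
by rewrite clamp_le0 ?H0 // subrr.
Qed.

Lemma homotopic_trans X Y (u v w : X -> Y) :
  homotopic R u v -> homotopic R v w -> homotopic R u w.
Proof.
move=> [H [H0 H1]] [K [K0 K1]].
pose G (p : X * I) : Y := if set_val p.2 <= 2^-1 :> R
  then H (p.1, clamp (2 * set_val p.2))
  else K (p.1, clamp (2 * set_val p.2 - 1)).
have c2 : continuous (fun t : I => 2 * set_val t : R).
  move=> t; apply: (@continuousM R I (cst 2) set_val);
    first exact: cst_continuous.
  exact: set_val_continuous.
have c21 : continuous (fun t : I => 2 * set_val t - 1 : R).
  move=> t; apply: (@continuousB R R^o I (fun t : I => 2 * set_val t) (cst 1)).
    exact: c2.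
  exact: cst_continuous.
have cval : continuous (fun p : X * I => set_val p.2 : R).
  exact: comp_continuous (@snd_continuous _ _) (@set_val_continuous _ _).
pose A := [set p : X * I | (set_val p.2 : R) <= 2^-1].
pose B := [set p : X * I | 2^-1 <= (set_val p.2 : R)].
have cA : closed A.
  by apply: (@preimage_closed _ R _ [set x | x <= 2^-1]) => [x _|];
    [exact: cval|exact: closed_le].
have cB : closed B.
  by apply: (@preimage_closed _ R _ [set x | 2^-1 <= x]) => [x _|];
    [exact: cval|exact: closed_ge].
have cG : continuous G.
  (* Pasting: [A] and [B] are closed and cover the product, so continuity on each of them
     suffices. *)
  apply/continuous_subspace_setT.
  have -> : [set: X * I] = A `|` B.
    by apply/esym/seteqP; split=> // p _; apply/orP; exact: le_total.
  apply: withinU_continuous => //.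
    have := continuous_subspaceT (A := A)
      (continuous_reparam (@cts_fun _ _ H) c2).
    by apply: subspace_eq_continuous => p; rewrite inE /from_subspace /G => ->.
  have := continuous_subspaceT (A := B)
    (continuous_reparam (@cts_fun _ _ K) c21).
  apply: subspace_eq_continuous => p; rewrite inE /from_subspace /G => Bp.
  (* On the overlap both formulas give [v]: [H] has ended there and [K] starts. *)
  case: ifP => // Ap; have -> : set_val p.2 = 2^-1.
    by apply/eqP; rewrite eq_le Ap.
  by rewrite divff ?pnatr_eq0 // clamp_le0 ?subrr // clamp_ge1 // K0 H1.
exists (mkcts cG); split=> x; rewrite /= /mkcts /G /=.
  by rewrite invr_ge0 ler0n mulr0 clamp_le0 ?H0.
rewrite invf_ge1 // ifF; last by apply/negbTE; rewrite -ltNge ltr1n.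
by rewrite mulr1 clamp_ge1 ?K1 // lerBrDr.
Qed.

End homotopy.

(** * From homotopies to relative paths *)

(** Curry the homotopy. It is taken after [set_val] because only its two ends must lie in [F]; in
    between it may run through all of [S]. *)
Lemma relative_paths_of_homotopy (R : realType) (X S : topologicalType)
    (F : set S) (u v : X -> set_type F) :
  homotopic R (set_val \o u) (set_val \o v) ->
  exists D : continuousType X (relative_paths R F),
    @endpoints R S F \o D = (fun x => (u x, v x)).
Proof.
move=> [H [H0 H1]].
have cH x : continuous (fun t => H (x, t)).
  exact: comp_continuous (pairr_continuous (x := x)) (@cts_fun _ _ H).
pose P x : path_space R S := mkcts (cH x).
have PF x : F (P x i0) /\ F (P x i1).
  by rewrite /= /mkcts H0 H1; split; exact: set_valP.
pose D x : relative_paths R F := exist _ (P x) (mem_set (PF x)).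
have cD : continuous D.
  apply/continuous_set_type/continuous_path_space.
  rewrite (_ : (fun p => _) = H); first exact: cts_fun.
  by apply/funext => -[].
exists (mkcts cD); apply/funext => x.
by congr pair; apply: val_inj; [exact: H0|exact: H1].
Qed.

(** * Lifting functions and the loops below relative paths *)

Section lifting.
Variables (R : realType) (S O : topologicalType) (f : continuousType S O).
Variables (L : lifting_function R f) (r : O).
Local Notation I := (unit_interval R).
Local Notation F := (fiber f r).
Local Notation Sigma := (relative_paths R (fiber_set f r)).

Lemma mk_lift_domain_eq (s s' : S) (a a' : path_space R O)
    (e : f s = a i0) (e' : f s' = a' i0) :
  s = s' -> a = a' -> mk_lift_domain e = mk_lift_domain e'.
Proof. by move=> ss' aa'; apply: val_inj; rewrite /= ss' aa'. Qed.

Lemma lift_app_continuous (X : topologicalType) (s : X -> S)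
    (a : X -> path_space R O) (t : X -> I) (e : forall x, f (s x) = a x i0) :
  continuous s -> continuous a -> continuous t ->
  continuous (fun x => L (mk_lift_domain (e x)) (t x)).
Proof.
move=> cs ca ct; apply: path_app_continuous => //.
apply: (@comp_continuous _ _ _ (fun x => mk_lift_domain (e x)));
  last exact: cts_fun.
by apply: continuous_set_type; exact: pair_continuous.
Qed.

Lemma Lf_function_continuous : continuous (Lf_function L (r := r)).
Proof.
apply: continuous_set_type.
change (continuous (fun p : loop_space R r * F =>
  L (mk_lift_domain (loop_fiber_start p.1 p.2)) i1)).
apply: lift_app_continuous.
- exact: comp_continuous (@snd_continuous _ _) (@set_val_continuous _ _).
- exact: comp_continuous (@fst_continuous _ _) (@set_val_continuous _ _).
- exact: cst_continuous.
Qed.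

(** The lifted path itself is the homotopy, from its start to its end. It may leave the fiber on the
    way, hence the [set_val] on both sides. *)
Lemma Lf_function_homotopic :
  homotopic R (fun p : loop_space R r * F => set_val p.2)
              (fun p => set_val (Lf_function L p)).
Proof.
pose H (p : (loop_space R r * F) * I) :=
  L (mk_lift_domain (loop_fiber_start p.1.1 p.1.2)) p.2.
have cH : continuous H.
  apply: lift_app_continuous; last exact: snd_continuous.
  - apply: (@comp_continuous _ _ _ (snd \o fst));
      last exact: set_val_continuous.
    exact: comp_continuous (@fst_continuous _ _) (@snd_continuous _ _).
  - apply: (@comp_continuous _ _ _ (fst \o fst));
      last exact: set_val_continuous.
    exact: comp_continuous (@fst_continuous _ _) (@fst_continuous _ _).
have := homotopicI cH.
rewrite (_ : (fun p => H (p, i0)) = fun p => set_val p.2) //.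
by apply/funext => p; exact: lift_start.
Qed.

Lemma rel_loop_subproof (a : Sigma) :
  Defs.map_path f (set_val a) i0 = r /\ Defs.map_path f (set_val a) i1 = r.
Proof. exact: set_valP a. Qed.

Definition rel_loop (a : Sigma) : loop_space R r :=
  exist _ (Defs.map_path f (set_val a)) (mem_set (rel_loop_subproof a)).

Lemma relative_path_eval_continuous :
  continuous (fun p : Sigma * I => set_val p.1 p.2).
Proof.
apply: path_app_continuous; last exact: snd_continuous.
exact: comp_continuous (@fst_continuous _ _) (@set_val_continuous _ _).
Qed.

Lemma rel_loop_continuous : continuous rel_loop.
Proof.
apply/continuous_set_type/continuous_path_space.
change (continuous (f \o (fun p : Sigma * I => set_val p.1 p.2))).
apply: comp_continuous; last exact: cts_fun.
exact: relative_path_eval_continuous.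
Qed.

Lemma endpoints_continuous : continuous (@endpoints R S (fiber_set f r)).
Proof.
have c (t : I) : continuous (fun a : Sigma => set_val a t).
  apply: path_app_continuous; first exact: set_val_continuous.
  exact: cst_continuous.
by apply: pair_continuous; apply: continuous_set_type; exact: c.
Qed.

Lemma tail_continuous (a : path_space R O) (t : I) :
  continuous (fun s => a (imax s t)).
Proof.
apply: (@comp_continuous _ _ _ (fun s => imax s t)); last exact: cts_fun.
by apply: imax_continuous; [move=> s; exact: cvg_id|exact: cst_continuous].
Qed.

(** Rests at [a t] up to time [t], then follows [a]. Using the maximum avoids rescaling: the tail is
    [a] for [t = 0] and constant at [a i1] for [t = 1]. *)
Definition tail (a : path_space R O) (t : I) : path_space R O :=
  mkcts (tail_continuous (a := a) (t := t)).

Lemma tail_start (a : path_space R S) (t : I) :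
  f (a t) = tail (Defs.map_path f a) t i0.
Proof. by rewrite /= /mkcts /= imax0. Qed.

(* Slide the starting point along [a] while lifting only what remains of
   [f \o a]; at time 1 a constant path is lifted, hence regularity. *)
Lemma Lf_function_rel_loop : regular_lifting L ->
  homotopic R (fun a : Sigma => Lf_function L (rel_loop a, (endpoints a).1))
              (fun a : Sigma => (endpoints a).2).
Proof.
move=> reg.
pose k (p : Sigma * I) := L (mk_lift_domain (tail_start (set_val p.1) p.2)) i1.
(* Every tail of [f \o a] ends where [f \o a] does, at [r], so this homotopy stays in the fiber. *)
have kF p : f (k p) = r.
  have /continuousEP/(_ i1) /= -> := lift_over L (tail_start (set_val p.1) p.2).
  by rewrite /mkcts imax1; exact: (rel_loop_subproof p.1).2.
pose K p : F := exist _ (k p) (mem_set (kF p)).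
have cK : continuous K.
  apply: continuous_set_type.
  change (continuous k); apply: lift_app_continuous.
  - exact: relative_path_eval_continuous.
  - apply: continuous_path_space.
    change (continuous (f \o
      (fun q : (Sigma * I) * I => set_val q.1.1 (imax q.2 q.1.2)))).
    apply: comp_continuous; last exact: cts_fun.
    apply: path_app_continuous.
      apply: (@comp_continuous _ _ _ (fst \o fst));
        last exact: set_val_continuous.
      exact: comp_continuous (@fst_continuous _ _) (@fst_continuous _ _).
    apply: imax_continuous; first exact: snd_continuous.
    exact: comp_continuous (@fst_continuous _ _) (@snd_continuous _ _).
  - exact: cst_continuous.
have := homotopicI cK.
congr homotopic; apply/funext => a; apply: val_inj => /=.
  congr (L _ i1); apply: mk_lift_domain_eq => //; apply/continuousEP => t.
  by rewrite /= /mkcts /= imaxC imax0.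
(* The constant tail is rewritten in the exact form that regularity speaks of. *)
transitivity (L (mk_lift_domain (f := f) (a := Defs.map_path f
  (const_path R (set_val a i1))) erefl) i1); last by rewrite reg.
congr (L _ i1); apply: mk_lift_domain_eq => //; apply/continuousEP => t.
by rewrite /= /mkcts /= imaxC imax1.
Qed.

End lifting.

(** * Assembly of the two fiber maps *)

Theorem theorem5p1 (R : realType) (S1 S2 O : topologicalType)
    (hausS1 : hausdorff_space S1) (hausS2 : hausdorff_space S2)
    (hausO : hausdorff_space O)
    (f1 : continuousType S1 O) (f2 : continuousType S2 O)
    (fib1 : regular_fibration R f1) (fib2 : regular_fibration R f2)
    (L1 : lifting_function R f1) (L2 : lifting_function R f2)
    (reg1 : regular_lifting L1) (reg2 : regular_lifting L2)
    (r : O)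
    (g : continuousType (fiber f1 r) (fiber f2 r))
    (g' : continuousType (fiber f2 r) (fiber f1 r))
    (gg' : homotopy_inverse R g g')
    (conj : homotopic R (Lf_function L1 (r := r))
              (g' \o Lf_function L2 (r := r) \o prod_map idfun g)) :
  exists (D : continuousType (relative_paths R (fiber_set f1 r))
                             (relative_paths R (fiber_set f2 r)))
         (E : continuousType (relative_paths R (fiber_set f2 r))
                             (relative_paths R (fiber_set f1 r))),
    @endpoints R S2 (fiber_set f2 r) \o D =
      prod_map g g \o @endpoints R S1 (fiber_set f1 r) /\
    @endpoints R S1 (fiber_set f1 r) \o E =
      prod_map g' g' \o @endpoints R S2 (fiber_set f2 r).
Proof.
have [_ gg'_id] := gg'.
pose p1 (a : relative_paths R (fiber_set f1 r)) :=
  (rel_loop a, (endpoints a).1).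
pose p2 (a : relative_paths R (fiber_set f2 r)) :=
  (rel_loop a, (endpoints a).1).
have ev0 (S : topologicalType) (f : continuousType S O) :
    continuous (fun a : relative_paths R (fiber_set f r) => (endpoints a).1).
  exact: comp_continuous (@endpoints_continuous _ _ _ f r)
    (@fst_continuous _ _).
have cp1 : continuous p1.
  exact: pair_continuous (@rel_loop_continuous _ _ _ f1 r) (ev0 _ f1).
have cp2 : continuous p2.
  exact: pair_continuous (@rel_loop_continuous _ _ _ f2 r) (ev0 _ f2).
have cidg (X Y Z : topologicalType) (h : continuousType Y Z) :
    continuous (prod_map (@idfun X) h).
  apply: pair_continuous; first exact: fst_continuous.
  exact: comp_continuous (@snd_continuous _ _) (@cts_fun _ _ h).
have cq1 : continuous (prod_map idfun g \o p1).
  exact: comp_continuous cp1 (cidg _ _ _ g).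
have cq2 : continuous (prod_map idfun g' \o p2).
  exact: comp_continuous cp2 (cidg _ _ _ g').
have cTh2 := @Lf_function_continuous _ _ _ _ L2 r.
have [|D DE] := @relative_paths_of_homotopy R _ _ (fiber_set f2 r)
    (fun a => g (endpoints a).1)
    (fun a : relative_paths R (fiber_set f1 r) => g (endpoints a).2).
  apply: homotopic_trans (homotopic_precomp cq1 (Lf_function_homotopic L2 r)) _.
  (* After the lift both ends lie in the fiber of [f2], so [set_val] can be stripped and the rest is
     done inside that fiber. *)
  apply: (@homotopic_postcomp _ _ _ _ set_val
    (Lf_function L2 (r := r) \o prod_map idfun g \o p1));
      first exact: set_val_continuous.
  (* Inserting [g \o g'] produces the right-hand side of [conj], which is then used backwards. *)
  apply: homotopic_trans (homotopic_sym (homotopic_precomp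
    (comp_continuous cq1 cTh2) gg'_id)) _.
  apply: (@homotopic_postcomp _ _ _ _ g
    (g' \o Lf_function L2 (r := r) \o prod_map idfun g \o p1));
      first exact: cts_fun.
  apply: homotopic_trans (homotopic_sym (homotopic_precomp cp1 conj)) _.
  exact: Lf_function_rel_loop.
have [|E EE] := @relative_paths_of_homotopy R _ _ (fiber_set f1 r)
    (fun a => g' (endpoints a).1)
    (fun a : relative_paths R (fiber_set f2 r) => g' (endpoints a).2).
  apply: homotopic_trans (homotopic_precomp cq2 (Lf_function_homotopic L1 r)) _.
  apply: (@homotopic_postcomp _ _ _ _ set_val
    (Lf_function L1 (r := r) \o prod_map idfun g' \o p2));
      first exact: set_val_continuous.
  (* Here [conj] is used forwards, at the fiber point [g' (a 0)]. *)
  apply: homotopic_trans (homotopic_precomp cq2 conj) _.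
  apply: (@homotopic_postcomp _ _ _ _ g' (Lf_function L2 (r := r) \o
    (fun a => (rel_loop a, g (g' (endpoints a).1))))); first exact: cts_fun.
  (* What remains is to contract [g \o g'] inside the argument of the second Lf-function, keeping
     the loop fixed. *)
  apply: (homotopic_trans _ (Lf_function_rel_loop r reg2)).
  apply: (@homotopic_postcomp _ _ _ _ _ _ p2 cTh2).
  apply: homotopic_pairr; first exact: rel_loop_continuous.
  exact: homotopic_precomp (ev0 _ f2) gg'_id.
by exists D, E.
Qed.
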